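(* Let $p$ be a prime. If $g\in\mathrm{PSL}(2,\mathbb{C}_p)$ is a parabolic element, then $$2^{-1}\varepsilon_2(g)\le M(g)\le\varepsilon_2(g),$$ where $\varepsilon_2(g)=\max\{\rho_v(g(0),0),\rho_v(g(\infty),\infty)\}$.
   Context: $\mathbb{C}_p$ is the completion of the algebraic closure of $\mathbb{Q}_p$, with $|p|=p^{-1}$. $\mathrm{PSL}(2,\mathbb{C}_p)=\mathrm{SL}(2,\mathbb{C}_p)/\{\pm I\}$ acts on $\mathbb{P}^1(\mathbb{C}_p)=\mathbb{C}_p\cup\{\infty\}$ by $z\mapsto\frac{az+b}{cz+d}$, $ad-bc=1$. A non-identity element $g$ is parabolic if every eigenvalue of $g$ has absolute value $1$ and $g$ cannot be conjugated to a diagonal matrix. Chordal metric: $\rho_v(z,w)=\frac{|z-w|}{\max\{1,|z|\}\max\{1,|w|\}}$ for $z,w\in\mathbb{C}_p$, $\rho_v(\infty,w)=\rho_v(w,\infty)=\frac1{\max\{1,|w|\}}$ for $w\in\mathbb{C}_p$, $\rho_v(\infty,\infty)=0$. Matrix norm: $\|(a_{ij})\|=\max_{i,j}|a_{ij}|$; $\|g\|$ is the norm of either lift of $g$ to $\mathrm{SL}(2,\mathbb{C}_p)$. Define $M(g)=\|g-g^{-1}\|/\|g\|$, where $g-g^{-1}$ is the difference of a lift of $g$ and the inverse matrix of that same lift; i.e. for $g(z)=\frac{az+b}{cz+d}$ with $ad-bc=1$, $M(g)=\frac{\max\{|a-d|,|2b|,|2c|\}}{\max\{|a|,|b|,|c|,|d|\}}$.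 *)

(* Defs.v *)
From HB Require Import structures.
From mathcomp Require Import all_boot all_order all_algebra all_reals.
From mathcomp Require Import generic_quotient.

Set Implicit Arguments.
Unset Strict Implicit.
Unset Printing Implicit Defensive.

Import Order.TTheory GRing.Theory Num.Theory.
Local Open Scope ring_scope.
Local Open Scope quotient_scope.

Record absval (R : realType) (K : fieldType) := AbsVal {
  absval_fun :> K -> R;
  absval_ge0 : forall x, 0 <= absval_fun x;
  absval_eq0 : forall x, (absval_fun x == 0) = (x == 0);
  absvalM : forall x y, absval_fun (x * y) = absval_fun x * absval_fun y;
  absvalD : forall x y,
    absval_fun (x + y) <= Num.max (absval_fun x) (absval_fun y)
}.

Definition padic_abs (R : realType) (p : nat) (x : rat) : R :=
  if x == 0 then 0
  else (p%:R : R) ^ ((logn p `|denq x|)%:Z - (logn p `|numq x|)%:Z).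

Section Completion.
Variables (R : realType) (K L : fieldType).
Implicit Types (vK : K -> R) (vL : absval R L) (i : {rmorphism K -> L}).

Definition isometric vK vL i : Prop := forall x, vL (i x) = vK x.

Definition dense_image vL i : Prop :=
  forall y e, 0 < e -> exists x, vL (y - i x) < e.

Definition cauchy_seq vL (u : nat -> L) : Prop :=
  forall e, 0 < e ->
    exists N, forall m n, (N <= m)%N -> (N <= n)%N -> vL (u m - u n) < e.

Definition seq_tends_to vL (u : nat -> L) (l : L) : Prop :=
  forall e, 0 < e -> exists N, forall n, (N <= n)%N -> vL (u n - l) < e.

Definition complete_absval vL : Prop :=
  forall u, cauchy_seq vL u -> exists l, seq_tends_to vL u l.

Definition is_completion vK vL i : Prop :=
  [/\ isometric vK vL i, dense_image vL i & complete_absval vL].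

Definition is_algebraic_closure i : Prop :=
  GRing.closed_field_axiom L /\ forall x : L, algebraicOver i x.

End Completion.

(* C_p is only defined up to isometric isomorphism: (C, v) is one of its       *)
(* models when it sits at the end of a tower Q -> Q_p -> Qbar_p -> C of a      *)
(* completion, an algebraic closure and a completion, with the absolute value  *)
(* of Qbar_p extending the one of Q_p.                                         *)
Definition is_Cp (p : nat) (R : realType) (C : fieldType) (v : absval R C)
    : Prop :=
  exists (Qp Qpbar : fieldType) (vQp : absval R Qp) (vQpbar : absval R Qpbar)
         (i : {rmorphism rat -> Qp}) (j : {rmorphism Qp -> Qpbar})
         (k : {rmorphism Qpbar -> C}),
  [/\ is_completion (padic_abs R p) vQp i,
      is_algebraic_closure j,
      isometric vQp vQpbar j
    & is_completion vQpbar v k].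

Lemma invmxN (K : fieldType) n (A : 'M[K]_n) :
  A \in unitmx -> invmx (- A) = - invmx A.
Proof.
move=> UA; have UN : - A \in unitmx.
  by rewrite -scaleN1r unitmxZ // unitrN1.
by rewrite -[RHS](mulKmx UN) mulNmx [A *m _]mulmxN opprK mulmxV ?mulmx1.
Qed.

Section SL2.
Variable K : fieldType.

Record SL2 := MkSL2 { sl2_mx : 'M[K]_2; _ : \det sl2_mx == 1 }.

HB.instance Definition _ := [isSub for sl2_mx].
HB.instance Definition _ := [Choice of SL2 by <:].

Implicit Types A B C : SL2.

Lemma det_sl2 A : \det (sl2_mx A) = 1.
Proof. by apply/eqP; case: A. Qed.

Lemma sl2_unitmx A : sl2_mx A \in unitmx.
Proof. by rewrite unitmxE det_sl2 unitr1. Qed.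

Fact sl2_one_subproof : \det (1%:M : 'M[K]_2) == 1.
Proof. by rewrite det1. Qed.
Definition sl2_one : SL2 := MkSL2 sl2_one_subproof.

Fact sl2_mul_subproof A B : \det (sl2_mx A *m sl2_mx B) == 1.
Proof. by rewrite det_mulmx !det_sl2 mulr1. Qed.
Definition sl2_mul A B : SL2 := MkSL2 (sl2_mul_subproof A B).

Fact sl2_inv_subproof A : \det (invmx (sl2_mx A)) == 1.
Proof. by rewrite det_inv det_sl2 invr1. Qed.
Definition sl2_inv A : SL2 := MkSL2 (sl2_inv_subproof A).

Fact sl2_mulA : associative sl2_mul.
Proof. by move=> A B C; apply: val_inj; rewrite /= mulmxA. Qed.
Fact sl2_mul1 : left_id sl2_one sl2_mul.
Proof. by move=> A; apply: val_inj; rewrite /= mul1mx. Qed.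
Fact sl2_mulr1 : right_id sl2_one sl2_mul.
Proof. by move=> A; apply: val_inj; rewrite /= mulmx1. Qed.
Fact sl2_mulV : left_inverse sl2_one sl2_inv sl2_mul.
Proof. by move=> A; apply: val_inj; rewrite /= mulVmx ?sl2_unitmx. Qed.
Fact sl2_mulrV : right_inverse sl2_one sl2_inv sl2_mul.
Proof. by move=> A; apply: val_inj; rewrite /= mulmxV ?sl2_unitmx. Qed.

HB.instance Definition _ :=
  isGroup.Build SL2 sl2_mulA sl2_mul1 sl2_mulr1 sl2_mulV sl2_mulrV.

Definition sl2_pm A B : bool :=
  (sl2_mx A == sl2_mx B) || (sl2_mx A == - sl2_mx B).

Fact sl2_pm_refl : reflexive sl2_pm.
Proof. by move=> A; rewrite /sl2_pm eqxx. Qed.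
Fact sl2_pm_sym : symmetric sl2_pm.
Proof.
by move=> A B; rewrite /sl2_pm eq_sym; congr (_ || _); rewrite eq_sym eqr_oppLR.
Qed.
Fact sl2_pm_trans : transitive sl2_pm.
Proof.
rewrite /sl2_pm => B A C /orP[] /eqP-> // /orP[] /eqP->;
  by rewrite ?opprK eqxx ?orbT.
Qed.

Canonical sl2_pm_equiv := EquivRel sl2_pm sl2_pm_refl sl2_pm_sym sl2_pm_trans.

Definition PSL2 := {eq_quot sl2_pm}.
HB.instance Definition _ := Choice.on PSL2.
HB.instance Definition _ := EqQuotient.on PSL2.

Implicit Types g h : PSL2.

(* One of the two lifts of g to SL(2, K); the quantities defined from it below  *)
(* are insensitive to a change of sign (moebius_pi, Mdist_pi).                 *)
Definition psl_lift g : SL2 := repr g.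
Definition psl_mx g : 'M[K]_2 := sl2_mx (psl_lift g).

Lemma psl_liftK g : \pi_PSL2 (psl_lift g) = g.
Proof. exact: reprK. Qed.

Lemma psl_piP A B :
  \pi_PSL2 A = \pi_PSL2 B <-> sl2_mx A = sl2_mx B \/ sl2_mx A = - sl2_mx B.
Proof.
split; first by move/eqmodP/orP => /= -[] /eqP; [left|right].
by move=> H; apply/eqmodP/orP; case: H => ->; rewrite eqxx; [left|right].
Qed.

Lemma psl_mx_pi A :
  psl_mx (\pi_PSL2 A) = sl2_mx A \/ psl_mx (\pi_PSL2 A) = - sl2_mx A.
Proof. by apply/psl_piP; rewrite psl_liftK. Qed.

Definition psl_one : PSL2 := \pi_PSL2 1%g.
Definition psl_mul g h : PSL2 := \pi_PSL2 (psl_lift g * psl_lift h)%g.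
Definition psl_inv g : PSL2 := \pi_PSL2 (psl_lift g)^-1%g.

Lemma psl_mul_pi A B : psl_mul (\pi A) (\pi B) = \pi_PSL2 (A * B)%g.
Proof.
apply/psl_piP; change (sl2_mx (psl_lift (\pi A) * psl_lift (\pi B))%g)
  with (psl_mx (\pi A) *m psl_mx (\pi B)); rewrite /=.
case: (psl_mx_pi A) => ->; case: (psl_mx_pi B) => ->;
  rewrite ?mulNmx ?mulmxN ?opprK;
  first [by left | by right].
Qed.

Lemma psl_inv_pi A : psl_inv (\pi A) = \pi_PSL2 A^-1%g.
Proof.
apply/psl_piP; change (sl2_mx (psl_lift (\pi A))^-1%g)
  with (invmx (psl_mx (\pi A))); rewrite /=.
by case: (psl_mx_pi A) => ->; [left|right; rewrite invmxN ?sl2_unitmx].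
Qed.

Fact psl_mulA : associative psl_mul.
Proof.
move=> f g h; rewrite -[f]psl_liftK -[g]psl_liftK -[h]psl_liftK.
move: (psl_lift f) (psl_lift g) (psl_lift h) => A B C.
by rewrite (psl_mul_pi B C) (psl_mul_pi A B) !psl_mul_pi mulgA.
Qed.
Fact psl_mul1 : left_id psl_one psl_mul.
Proof. by move=> g; rewrite -[g]psl_liftK psl_mul_pi mul1g. Qed.
Fact psl_mulr1 : right_id psl_one psl_mul.
Proof. by move=> g; rewrite -[g]psl_liftK psl_mul_pi mulg1. Qed.
Fact psl_mulV : left_inverse psl_one psl_inv psl_mul.
Proof. by move=> g; rewrite -[g]psl_liftK psl_inv_pi psl_mul_pi mulVg. Qed.
Fact psl_mulrV : right_inverse psl_one psl_inv psl_mul.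
Proof. by move=> g; rewrite -[g]psl_liftK psl_inv_pi psl_mul_pi mulgV. Qed.

HB.instance Definition _ :=
  isGroup.Build PSL2 psl_mulA psl_mul1 psl_mulr1 psl_mulV psl_mulrV.

(* The projective line K + {oo}, with None standing for oo. *)
Definition P1 := option K.

Definition moebius_mx (A : 'M[K]_2) (z : P1) : P1 :=
  let a := A 0 0 in let b := A 0 1 in let c := A 1 0 in let d := A 1 1 in
  match z with
  | Some x => if c * x + d == 0 then None else Some ((a * x + b) / (c * x + d))
  | None => if c == 0 then None else Some (a / c)
  end.

Definition moebius g : P1 -> P1 := moebius_mx (psl_mx g).

Lemma moebius_pi A : moebius (\pi_PSL2 A) =1 moebius_mx (sl2_mx A).
Proof.
move=> z; rewrite /moebius; case: (psl_mx_pi A) => -> //.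
by case: z => [x|]; rewrite /moebius_mx !mxE ?[- _ * x]mulNr -?opprD
  oppr_eq0 invrN mulrNN.
Qed.

End SL2.

Section Metric.
Variables (R : realType) (K : fieldType) (v : absval R K).
Implicit Types (g h : PSL2 K).

Definition chordal (x y : P1 K) : R :=
  match x, y with
  | Some z, Some w => v (z - w) / (Num.max 1 (v z) * Num.max 1 (v w))
  | None, Some w => (Num.max 1 (v w))^-1
  | Some z, None => (Num.max 1 (v z))^-1
  | None, None => 0
  end.

Definition mxnorm (A : 'M[K]_2) : R :=
  \big[Num.max/0]_(i < 2) \big[Num.max/0]_(j < 2) v (A i j).

Definition Mdist g : R :=
  mxnorm (psl_mx g - invmx (psl_mx g)) / mxnorm (psl_mx g).

Definition eps2 g : R :=
  Num.max (chordal (moebius g (Some 0)) (Some 0))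
          (chordal (moebius g None) None).

Definition parabolic g : Prop :=
  [/\ g <> 1%g,
      forall l : K, eigenvalue (psl_mx g) l -> v l = 1
    & ~ exists h, is_diag_mx (psl_mx (g ^ h)%g)].

Lemma absval1 : v 1 = 1.
Proof.
have n0 : v 1 != 0 by rewrite absval_eq0 oner_eq0.
by apply: (mulfI n0); rewrite -absvalM !mulr1.
Qed.

Lemma absvalN x : v (- x) = v x.
Proof.
suff N1 : v (- 1) = 1 by rewrite -mulN1r absvalM N1 mul1r.
have : v (-1) ^+ 2 == 1 by rewrite expr2 -absvalM mulrNN mulr1 absval1.
by rewrite sqrp_eq1 ?absval_ge0 // => /eqP.
Qed.

Lemma mxnormN A : mxnorm (- A) = mxnorm A.
Proof.
by apply: eq_bigr => i _; apply: eq_bigr => j _; rewrite mxE absvalN.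
Qed.

Lemma Mdist_pi (A : SL2 K) :
  Mdist (\pi_(PSL2 K) A) =
  mxnorm (sl2_mx A - invmx (sl2_mx A)) / mxnorm (sl2_mx A).
Proof.
rewrite /Mdist; case: (psl_mx_pi A) => -> //.
by rewrite (invmxN (sl2_unitmx A)) -opprD !mxnormN.
Qed.

End Metric.

(* Main.v *)
Require Import Defs.
From mathcomp Require Import all_boot all_order all_algebra all_reals.
From mathcomp Require Import ring lra generic_quotient.
Set Implicit Arguments.
Unset Strict Implicit.
Unset Printing Implicit Defensive.
Import Order.TTheory GRing.Theory Num.Theory.
Local Open Scope ring_scope.

(** Let A, with entries a, b, c, d, be a lift of g.
    A 2 x 2 matrix with two distinct eigenvalues is diagonalizable, so a
    parabolic A has a double eigenvalue, provided that its characteristic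
    polynomial splits; the discriminant of that polynomial being tr^2 - 4, this
    means tr^2 = 4 ([parabolic_trace]).

    The splitting only asks for square roots in the field.  They are obtained
    from those of the algebraically closed dense subfield: if w is a
    sufficiently good approximate root of s <> 0, then every better approximate
    root is, up to sign, close to w, and on the roots so chosen
    |z - z'| = |z^2 - z'^2| / |2w|; hence they converge
    ([completion_sqrt]).

    Once tr^2 = 4, put u = (a - d)/2 and B = max(|b|, |c|).  The equation
    det A = 1 becomes u^2 = -bc, so |u| <= B, and A - A^-1 = 2A - tr A gives
    ||A - A^-1|| = |2| B.  Moreover a and d are (a + d)/2 + u and (a + d)/2 - u
    with |(a + d)/2| = 1, hence ||A|| <= max(1, B), and |a| = |d| = 1 when
    B < 1.  The two chordal distances in eps2 are |b| / max(|b|, |d|) and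
    |c| / max(|a|, |c|).  Their maximum is at least B / ||A||, since each
    denominator is at most ||A||; it is also at most B / ||A||, which is >= 1 if
    B >= 1 and >= B if B < 1.  So M(g) = |2| eps2(g), and the claim follows from
    1/2 <= |2| <= 1 ([Mdist_parabolic], [eps2_Mdist_estimate]). *)

(** * Two by two matrices *)

Lemma ord2P (P : 'I_2 -> Prop) : P 0 -> P 1 -> forall i, P i.
Proof.
move=> P0 P1 [[|[|//]] lt_i2].
  by rewrite (_ : Ordinal _ = 0) //; apply: val_inj.
by rewrite (_ : Ordinal _ = 1) //; apply: val_inj.
Qed.

Lemma lift_ord0_2 : lift ord0 ord0 = 1 :> 'I_2.
Proof. exact: val_inj. Qed.

Section TwoByTwo.
Variable K : fieldType.
Implicit Types A P : 'M[K]_2.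

Lemma mxtrace2 A : \tr A = A 0 0 + A 1 1.
Proof. by rewrite /mxtrace !big_ord_recl big_ord0 addr0 lift_ord0_2. Qed.

Lemma det_mx2 A : \det A = A 0 0 * A 1 1 - A 0 1 * A 1 0.
Proof.
rewrite (expand_det_row _ 0) !big_ord_recl big_ord0 addr0 lift_ord0_2.
rewrite /cofactor !det_mx11 !mxE /= lift_ord0_2.
rewrite (_ : lift 1 0 = 0) ?expr0 ?expr1 ?mul1r ?mulN1r ?mulrN //.
exact: val_inj.
Qed.

(** Cayley-Hamilton in dimension 2, with the adjugate written tr A - A. *)
Lemma mulmx_trace_sub A : A *m ((\tr A)%:M - A) = (\det A)%:M.
Proof.
apply/matrixP; elim/ord2P; elim/ord2P;
  rewrite !mxE !big_ord_recl big_ord0 lift_ord0_2 !mxE /= mxtrace2 det_mx2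
    ?mulr1n ?mulr0n; ring.
Qed.

Lemma sub_invmx2 A : \det A = 1 -> A - invmx A = A *+ 2 - (\tr A)%:M.
Proof.
move=> detA; have uA : A \in unitmx by rewrite unitmxE detA unitr1.
rewrite (_ : invmx A = (\tr A)%:M - A); first by rewrite opprB addrA mulr2n.
by rewrite -[RHS](mulKmx uA) mulmx_trace_sub detA mulmx1.
Qed.

(** By Cayley-Hamilton, A is a root of the separable polynomial
    (X - l) (X - m). *)
Lemma diagonalizable2 A l m :
  l != m -> l + m = \tr A -> l * m = \det A ->
  exists2 P, P \in unitmx & is_diag_mx (P *m A *m invmx P).
Proof.
move=> neq_lm tr_lm det_lm.
have [_ /(_ _)[]] := diagonalizableP A.
  exists [:: l; m]; first by rewrite /= inE neq_lm.
  apply/mxminpoly_minP; rewrite !big_cons big_nil mulr1 rmorphM !rmorphB /=.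
  rewrite horner_mx_X !horner_mx_C -mulmxE mulmxBl !mulmxBr.
  rewrite -[l%:M *m m%:M]scalar_mxM det_lm -mulmx_trace_sub -tr_lm.
  rewrite (raddfD (@scalar_mx K 2)) /=.
  rewrite mulmxBr mulmxDr -(scalar_mxC l A) opprB.
  by rewrite [A *m l%:M + _]addrC [_ - A *m l%:M]addrAC addrK addrA subrK subrr.
by move=> P uP; rewrite /similar_to /= conjumx // => diagP; exists P.
Qed.

End TwoByTwo.

(** A diagonalizing matrix may be multiplied on the left by any invertible
    diagonal matrix D, because D commutes with the diagonal form; D is taken to
    normalize the determinant. *)
Lemma det1_diagonalizer (K : fieldType) (P A : 'M[K]_2) :
    P \in unitmx -> is_diag_mx (P *m A *m invmx P) ->
  exists2 Q, \det Q = 1 & is_diag_mx (Q *m A *m invmx Q).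
Proof.
move=> uP diagP.
pose D := diag_mx (\row_(i < 2) (if i == 0 then (\det P)^-1 else 1)).
have detP : \det P != 0 by rewrite -unitfE -unitmxE.
have detD : \det D = (\det P)^-1.
  by rewrite det_diag !big_ord_recl big_ord0 !mxE /= !mulr1.
have detQ : \det (D *m P) = 1 by rewrite det_mulmx detD mulVf.
have uQ : D *m P \in unitmx by rewrite unitmxE detQ unitr1.
exists (D *m P) => //.
rewrite (_ : _ *m invmx _ = P *m A *m invmx P) //.
apply: (canLR (mulmxK uQ)); have /diag_mxP[d PAP] := diagP.
by rewrite mulmxA PAP -diag_mxC -PAP -[RHS]mulmxA mulmxKV // mulmxA.
Qed.

(** * Ultrametric absolute values and square roots in a completion *)

Section Ultrametric.
Variables (R : realType) (K : fieldType) (v : absval R K).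

Lemma absval0 : v 0 = 0.
Proof. by apply/eqP; rewrite absval_eq0. Qed.

Lemma absvalB x y : v (x - y) <= Num.max (v x) (v y).
Proof. by rewrite -[v y]absvalN absvalD. Qed.

Lemma absval_lt_add e x y : v x < e -> v y < e -> v (x + y) < e.
Proof.
by move=> xe ye; rewrite (le_lt_trans (absvalD _ _ _)) // gt_max xe ye.
Qed.

Lemma absval_lt_sub e x y : v x < e -> v y < e -> v (x - y) < e.
Proof. by move=> xe ye; rewrite absval_lt_add ?absvalN. Qed.

Lemma absval_le_add e x y : v x <= e -> v y <= e -> v (x + y) <= e.
Proof.
by move=> xe ye; rewrite (le_trans (absvalD _ _ _)) // ge_max xe ye.
Qed.

Lemma absval_add_small x y : v y < v x -> v (x + y) = v x.
Proof.
move=> ltyx; apply/eqP; rewrite eq_le; apply/andP; split.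
  by apply: absval_le_add => //; apply: ltW.
rewrite leNgt; apply/negP => lt_xy.
by have := absval_lt_sub lt_xy ltyx; rewrite addrK ltxx.
Qed.

Lemma absval2_le1 : v 2 <= 1.
Proof. by apply: absval_le_add; rewrite absval1. Qed.

End Ultrametric.

(** The two square roots of an element are a distance |2w| apart, so the choice
    of sign that makes approximate roots converge can be made once and for all,
    by comparison with a fixed approximate root w; each term of the sequence is
    then chosen independently of the others. *)
Lemma completion_sqrt (R : realType) (K L : fieldType) (v : absval R L)
    (i : {rmorphism K -> L}) :
    dense_image v i -> complete_absval v -> GRing.closed_field_axiom K ->
  (2 : L) != 0 -> forall s : L, exists r, r ^+ 2 = s.
Proof.
move=> dense_i complete_v closedK nz2 s.
have [-> | nz_s] := eqVneq s 0; first by exists 0; rewrite expr0n.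
have v_gt0 x : x != 0 -> 0 < v x.
  by move=> nz_x; rewrite lt_def absval_eq0 nz_x absval_ge0.
have approx e : 0 < e -> exists y : K, v (i y ^+ 2 - s) < e.
  move=> e_gt0; have [x xs] := dense_i s e e_gt0.
  have [y yx] := closedK 2%N (fun k => if k is 0%N then x else 0) isT.
  exists y; rewrite -rmorphXn yx !big_ord_recl big_ord0 /= mulr1 mul0r !addr0.
  by rewrite -absvalN opprB.
(* Within |2|^2 |s| of s, a square has the absolute value of s, and its root
   is nearer to one of w, -w than |2w|. *)
have v2s_gt0 : 0 < v 2 ^+ 2 * v s by rewrite mulr_gt0 ?exprn_gt0 ?v_gt0.
have [y0 y0s] := approx _ v2s_gt0; set w := i y0 in y0s.
have vw2 : v w ^+ 2 = v s.
  rewrite expr2 -absvalM -expr2 -[w ^+ 2](subrK s) addrC absval_add_small //.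
  rewrite (lt_le_trans y0s) // ler_piMl ?absval_ge0 //.
  by rewrite exprn_ile1 ?absval_ge0 ?absval2_le1.
have v2w_gt0 : 0 < v (2 * w).
  rewrite absvalM mulr_gt0 ?v_gt0 // -(absval_eq0 v).
  by apply: contra_eq_neq vw2 => ->; rewrite expr0n /= lt_eqF ?v_gt0.
have near e : 0 < e ->
    exists z : K, (v (i z ^+ 2 - s) < e) && (v (i z - w) < v (2 * w)).
  move=> e_gt0; have m_gt0 : 0 < Num.min e (v 2 ^+ 2 * v s).
    by rewrite lt_min e_gt0.
  have [y] := approx _ m_gt0; rewrite lt_min => /andP[ye ys].
  have [lt_yw | ge_yw] := ltP (v (i y - w)) (v (2 * w)).
    by exists y; rewrite ye.
  exists (- y); rewrite rmorphN sqrrN ye /= -opprD absvalN ltNge.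
  apply/negP => ge_yw'; have := absval_lt_sub ys y0s.
  rewrite opprB addrA subrK subr_sqr absvalM ltNge -vw2 -exprMn.
  by rewrite -(absvalM v 2) expr2 ler_pM ?absval_ge0.
have eps_gt0 n : 0 < (n.+1%:R : R)^-1 by rewrite invr_gt0 ltr0n.
pose z n := i (xchoose (near _ (eps_gt0 n))).
have zs n : v (z n ^+ 2 - s) < n.+1%:R^-1.
  by case/andP: (xchooseP (near _ (eps_gt0 n))).
have zw n : v (z n - w) < v (2 * w).
  by case/andP: (xchooseP (near _ (eps_gt0 n))).
have eps_small (e : R) : 0 < e ->
    exists N, forall n, (N <= n)%N -> (n.+1%:R : R)^-1 < e.
  move=> e_gt0; exists (Num.truncn e^-1) => n leNn.
  rewrite invf_plt ?posrE ?ltr0n // (lt_le_trans (truncnS_gt _)) //.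
  by rewrite ler_nat.
(* z m + z n is 2w up to a smaller error, so |z m - z n| is controlled by the
   difference of the squares. *)
have vzD m n : v (z m + z n) = v (2 * w).
  have ->: z m + z n = 2 * w + ((z m - w) + (z n - w)) by ring.
  by rewrite absval_add_small // absval_lt_add.
have [l zl] : exists l, seq_tends_to v z l.
  apply: complete_v => e e_gt0.
  have [N small] := eps_small _ (mulr_gt0 e_gt0 v2w_gt0).
  exists N => m n leNm leNn; rewrite -(ltr_pM2r v2w_gt0) -{1}(vzD m n).
  rewrite -absvalM -subr_sqr.
  have ->: z m ^+ 2 - z n ^+ 2 = (z m ^+ 2 - s) - (z n ^+ 2 - s) by ring.
  by apply: absval_lt_sub; [exact: lt_trans (zs _) (small _ _)
                           |exact: lt_trans (zs _) (small _ _)].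
exists l; apply/eqP; rewrite -subr_eq0 -(absval_eq0 v).
rewrite eq_le absval_ge0 andbT leNgt; apply/negP => d_gt0.
set d := v (l ^+ 2 - s) in d_gt0.
pose B := 1 + Num.max (v l) (v w).
have B_gt0 : 0 < B by rewrite ltr_pwDl // le_max absval_ge0.
have [N1 zl1] := zl _ (divr_gt0 d_gt0 B_gt0).
have [N2 small] := eps_small _ d_gt0.
pose n := maxn N1 N2.
have vz : v (z n) <= v w.
  rewrite -[z n](subrK w) absval_le_add // (le_trans (ltW (zw n))) //.
  by rewrite absvalM ler_piMl ?absval_ge0 ?absval2_le1.
suff: d < d by rewrite ltxx.
(* l^2 - s splits into two terms that are both smaller than |l^2 - s|. *)
have {1}->: d = v ((z n ^+ 2 - s) - (z n - l) * (z n + l)).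
  by congr (v _); ring.
apply: absval_lt_sub; first exact: lt_trans (zs _) (small _ (leq_maxr _ _)).
have vzl : v (z n + l) <= B.
  rewrite (le_trans (absvalD _ _ _)) // ler_wpDl // ge_max !le_max lexx.
  by rewrite vz orbT.
rewrite absvalM -(divfK (lt0r_neq0 B_gt0) d).
apply: le_lt_trans (_ : _ <= v (z n - l) * B) _.
  by rewrite ler_wpM2l ?absval_ge0.
by rewrite ltr_pM2r // zl1 ?leq_maxl.
Qed.

(** * The field of p-adic complex numbers *)

Lemma Cp_absval_rat (R : realType) (p : nat) (Cp : fieldType)
    (v : absval R Cp) : is_Cp p v ->
  exists q : {rmorphism rat -> Cp},
  forall x, v (q x) = padic_abs R p x.
Proof.
case=> Qp [Qpb [vQp [vQpb [i [j [k]]]]]].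
case=> -[iso_i _ _] _ iso_j [iso_k _ _].
by exists (k \o j \o i) => x; rewrite /= iso_k iso_j iso_i.
Qed.

Lemma Cp_absval2_ge (R : realType) (p : nat) (Cp : fieldType)
    (v : absval R Cp) : is_Cp p v ->
  2^-1 <= v 2.
Proof.
move=> /Cp_absval_rat[q vq]; rewrite -[2 : Cp](rmorph_nat q) vq.
rewrite /padic_abs pnatr_eq0 /= logn1 sub0r (logn_prime p (isT : prime 2)).
case: eqP => [->|_]; first by rewrite exprN1.
by rewrite oppr0 expr0z; lra.
Qed.

Lemma Cp_neq2_0 (R : realType) (p : nat) (Cp : fieldType)
    (v : absval R Cp) : is_Cp p v -> (2 : Cp) != 0.
Proof.
move=> /Cp_absval2_ge v2; rewrite -(absval_eq0 v) gt_eqF //.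
by rewrite (lt_le_trans _ v2) // invr_gt0 ltr0n.
Qed.

Lemma Cp_sqrt (R : realType) (p : nat) (Cp : fieldType)
    (v : absval R Cp) : is_Cp p v ->
  forall s : Cp, exists r, r ^+ 2 = s.
Proof.
move=> Cp_v; have nz2 := Cp_neq2_0 Cp_v.
have [Qp [Qpb [vQp [vQpb [i [j [k]]]]]]] := Cp_v.
case=> _ [closed_Qpb _] _ [_ dense_k complete_v].
exact: completion_sqrt dense_k complete_v closed_Qpb nz2.
Qed.

(** * Parabolic elements *)

Local Open Scope quotient_scope.

(** Otherwise the eigenvalues (t + r) / 2 and (t - r) / 2, with r^2 = t^2 - 4,
    are distinct, and g is conjugate to a diagonal element of PSL(2, K). *)
Lemma parabolic_trace (R : realType) (K : fieldType) (v : absval R K)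
    (g : PSL2 K) :
    (2 : K) != 0 -> (forall s : K, exists r, r ^+ 2 = s) ->
  parabolic v g -> (\tr (psl_mx g)) ^+ 2 = 4.
Proof.
move=> nz2 sqrtK [_ _ ndiag]; apply/eqP/negPn/negP => tr_neq; apply: ndiag.
have [P uP diagP] : exists2 P, P \in unitmx &
    is_diag_mx (P *m psl_mx g *m invmx P).
  have detg : \det (psl_mx g) = 1 by exact: det_sl2.
  have {tr_neq}[t trE t2_neq] : exists2 t, t = \tr (psl_mx g) & t ^+ 2 != 4.
    by exists (\tr (psl_mx g)).
  have [r r2] := sqrtK (t ^+ 2 - 4).
  have nz_r : r != 0.
    apply: contra_neq t2_neq => r0; apply/eqP.
    by rewrite -subr_eq0 -r2 r0 expr0n.
  apply: (@diagonalizable2 _ _ ((t + r) / 2) ((t - r) / 2)).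
  - rewrite -subr_eq0 (_ : _ - _ = r) //; field; exact: nz2.
  - by rewrite -trE; field; exact: nz2.
  have nz4 : (4 : K) != 0 by rewrite (natrM _ 2 2) mulf_neq0.
  rewrite detg (_ : _ * _ = (t ^+ 2 - r ^+ 2) / 4).
    by rewrite r2; field; exact: nz4.
  by field; rewrite nz4.
have [Q detQ diagQ] := det1_diagonalizer uP diagP.
pose h : SL2 K := MkSL2 (introT eqP detQ).
exists (\pi_(PSL2 K) h^-1)%g.
have -> : (g ^ \pi_(PSL2 K) h^-1 = \pi_(PSL2 K) (h * psl_lift g * h^-1))%g.
  rewrite -{1}[g]psl_liftK.
  change (psl_mul (psl_inv (\pi_(PSL2 K) h^-1)%g)
    (psl_mul (\pi_(PSL2 K) (psl_lift g)) (\pi_(PSL2 K) h^-1)%g) =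
    \pi_(PSL2 K) (h * psl_lift g * h^-1))%g.
  by rewrite psl_inv_pi (psl_mul_pi (psl_lift g)) psl_mul_pi invgK mulgA.
case: (psl_mx_pi (h * psl_lift g * h^-1)%g) => ->; first exact: diagQ.
have /is_diag_mxP dQ := diagQ; apply/is_diag_mxP => i j neq_ij.
by rewrite mxE dQ ?oppr0.
Qed.

Section Estimates.
Variables (R : realType) (K : fieldType) (v : absval R K).
Implicit Types (A : 'M[K]_2) (g : PSL2 K).

Lemma mxnorm2E A :
  mxnorm v A = Num.max (Num.max (v (A 0 0)) (v (A 0 1)))
                       (Num.max (v (A 1 0)) (v (A 1 1))).
Proof.
rewrite /mxnorm !big_ord_recl !big_ord0 lift_ord0_2.
by rewrite !(max_l (y := 0)) // ?le_max absval_ge0.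
Qed.

Lemma max1_div (x y : K) : y != 0 ->
  Num.max 1 (v (x / y)) = Num.max (v x) (v y) / v y.
Proof.
move=> nz_y; have vy_gt0 : 0 < v y by rewrite lt_def absval_eq0 nz_y absval_ge0.
have -> : v (x / y) = v x / v y.
  by apply: (canRL (mulfK (lt0r_neq0 vy_gt0))); rewrite -absvalM divfK.
by rewrite maxC maxr_pMl ?invr_ge0 ?(ltW vy_gt0) // divff ?lt0r_neq0.
Qed.

Lemma chordal_moebius0 A : \det A != 0 ->
  chordal v (moebius_mx A (Some 0)) (Some 0) =
  v (A 0 1) / Num.max (v (A 0 1)) (v (A 1 1)).
Proof.
rewrite det_mx2 /= !mulr0 !add0r.
have [d0 | nz_d] := eqVneq (A 1 1) 0 => det_nz /=.
  rewrite d0 absval0 (max_l (x := 1)) // max_l ?absval_ge0 // invr1 divff //.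
  by rewrite absval_eq0; apply: contra_neq det_nz => b0; rewrite b0 d0; ring.
by rewrite subr0 absval0 [Num.max 1 0]max_l // mulr1 max1_div // invf_div mulrA
  -absvalM divfK.
Qed.

Lemma chordal_moebius_infty A : \det A != 0 ->
  chordal v (moebius_mx A None) None =
  v (A 1 0) / Num.max (v (A 0 0)) (v (A 1 0)).
Proof.
rewrite det_mx2 /=; have [c0 | nz_c] := eqVneq (A 1 0) 0 => det_nz /=.
  by rewrite c0 absval0 mul0r.
by rewrite max1_div // invf_div.
Qed.

(** The exact value of M(g); it yields the two inequalities by bounding |2|. *)
Lemma Mdist_parabolic g : (2 : K) != 0 -> (\tr (psl_mx g)) ^+ 2 = 4 ->
  Mdist v g = v 2 * eps2 v g.
Proof.
have detA : \det (psl_mx g) = 1 by exact: det_sl2.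
move=> nz2 trA; rewrite /Mdist /eps2 /moebius.
rewrite chordal_moebius0 ?chordal_moebius_infty ?detA ?oner_eq0 //.
have := detA; have := trA.
rewrite sub_invmx2 // !mxnorm2E !mxE mxtrace2 det_mx2 /=.
move: (psl_mx g 0 0) (psl_mx g 0 1) (psl_mx g 1 0) (psl_mx g 1 1).
move=> a b c d tr2 det1.
rewrite !mulr1n !mulr0n !subr0.
pose u := (a - d) / 2; pose B := Num.max (v b) (v c).
have u2 : u ^+ 2 = - (b * c).
  have nz4 : (4 : K) != 0 by rewrite (natrM _ 2 2) mulf_neq0.
  apply: (mulfI nz4).
  have -> : 4 * u ^+ 2 = (a + d) ^+ 2 - 4 * (a * d) by rewrite /u; field.
  by rewrite tr2 (_ : a * d = 1 + b * c); [ring | rewrite -det1; ring].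
have uB : v u <= B.
  rewrite -(@ler_pXn2r _ 2) ?nnegrE ?le_max ?absval_ge0 //.
  rewrite expr2 -absvalM -expr2 u2 absvalN absvalM expr2.
  by rewrite ler_pM ?absval_ge0 // le_max lexx ?orbT.
have half : v ((a + d) / 2) = 1.
  apply/eqP; rewrite -(@pexpr_eq1 _ _ 2) ?absval_ge0 // expr2 -absvalM -expr2.
  rewrite expr_div_n tr2 (_ : 4 = 2 ^+ 2); last by ring.
  by rewrite divff ?absval1 ?expf_neq0.
have aE : a = (a + d) / 2 + u by rewrite /u; field; exact: nz2.
have dE : d = (a + d) / 2 - u by rewrite /u; field; exact: nz2.
have -> : Num.max (Num.max (v (a + a - (a + d))) (v (b + b)))
                  (Num.max (v (c + c)) (v (d + d - (a + d)))) = v 2 * B.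
  rewrite (_ : a + a - (a + d) = 2 * u); last by rewrite /u; field; exact: nz2.
  rewrite (_ : d + d - (a + d) = - (2 * u)); last first.
    by rewrite /u; field; exact: nz2.
  rewrite -[b + b]mulr2n -[c + c]mulr2n -[b *+ 2]mulr_natl -[c *+ 2]mulr_natl.
  rewrite absvalN !(absvalM v 2) [Num.max (v 2 * v c) _]maxC maxACA maxxx.
  by rewrite -maxr_pMr ?absval_ge0 // max_r // ler_wpM2l ?absval_ge0.
set N := Num.max (Num.max (v a) (v b)) _.
have N_gt0 : 0 < N.
  rewrite (lt_le_trans _ (_ : v 2 <= N)) //.
    by rewrite lt_def absval_eq0 nz2 absval_ge0.
  have -> : v 2 = v (a + d).
    by rewrite -[a + d](divfK nz2) absvalM half mul1r.
  by rewrite (le_trans (absvalD _ _ _)) // ge_max !le_max !lexx ?orbT.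
have N_le : N <= Num.max 1 B.
  rewrite !ge_max; apply/andP; split; apply/andP; split.
  - rewrite aE (le_trans (absvalD _ _ _)) // half ge_max le_max lexx /=.
    by rewrite le_max uB orbT.
  - by rewrite !le_max lexx !orbT.
  - by rewrite !le_max lexx !orbT.
  rewrite dE (le_trans (absvalB _ _ _)) // half ge_max le_max lexx /=.
  by rewrite le_max uB orbT.
have diag1 : B < 1 -> v a = 1 /\ v d = 1.
  move=> B_lt1; have u_lt1 := le_lt_trans uB B_lt1.
  by split; [rewrite aE | rewrite dE]; rewrite absval_add_small ?absvalN half.
(* Applied to (|b|, |d|) and to (|c|, |a|). *)
have le_BN x y : 0 <= x -> x <= B -> (B < 1 -> y = 1) ->
    x / Num.max x y <= B / N.
  move=> x0 xB y1; have [B1 | B1] := leP 1 B.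
    apply: (@le_trans _ _ 1).
      have [m0|m_gt0] := eqVneq (Num.max x y) 0.
        by rewrite m0 invr0 mulr0.
      rewrite ler_pdivrMr ?mul1r ?le_max ?lexx // lt_def m_gt0 le_max.
      by rewrite x0.
    rewrite ler_pdivlMr // mul1r (le_trans N_le) //.
    by rewrite ge_max B1 lexx.
  rewrite y1 // max_r ?(le_trans xB (ltW B1)) // divr1 (le_trans xB) //.
  rewrite ler_pdivlMr // ler_piMr ?(le_trans x0 xB) // (le_trans N_le) //.
  by rewrite ge_max lexx ltW.
have div_anti x m : 0 <= x -> x <= m -> m <= N -> x / N <= x / m.
  move=> x0 xm mN; have [-> | nz_x] := eqVneq x 0; first by rewrite !mul0r.
  have m_gt0 : 0 < m by rewrite (lt_le_trans _ xm) // lt_def nz_x.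
  by rewrite ler_wpM2l // lef_pV2.
rewrite -mulrA; congr (_ * _); apply: le_anti; apply/andP; split.
  rewrite le_max; apply/orP; rewrite /B.
  have [bc | cb] := leP (v b) (v c); [right | left].
    by apply: div_anti; rewrite ?absval_ge0 // /N ?ge_max !le_max !lexx ?orbT.
  by apply: div_anti; rewrite ?absval_ge0 // /N ?ge_max !le_max !lexx ?orbT.
rewrite ge_max le_BN ?absval_ge0 //=; last by case/diag1.
  by rewrite maxC le_BN ?absval_ge0 ?le_max ?lexx ?orbT // => /diag1[].
by rewrite le_max lexx.
Qed.

Lemma eps2_Mdist_estimate g :
    2^-1 <= v 2 -> (2 : K) != 0 -> (\tr (psl_mx g)) ^+ 2 = 4 ->
  2^-1 * eps2 v g <= Mdist v g <= eps2 v g.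
Proof.
move=> v2 nz2 trg; rewrite Mdist_parabolic //.
have e_ge0 : 0 <= eps2 v g.
  rewrite /eps2 /moebius !(chordal_moebius0, chordal_moebius_infty);
    rewrite ?[\det _]det_sl2 ?oner_eq0 //.
  by rewrite le_max divr_ge0 ?absval_ge0 // le_max absval_ge0.
by rewrite ler_wpM2r // ler_piMl // absval2_le1.
Qed.

End Estimates.

Theorem corollary1p8 (R : realType) (p : nat) (p_prime : prime p)
    (Cp : fieldType) (v : absval R Cp) (Cp_v : is_Cp p v)
    (g : PSL2 Cp) (g_parabolic : parabolic v g) :
  2^-1 * eps2 v g <= Mdist v g <= eps2 v g.
Proof.
have nz2 := Cp_neq2_0 Cp_v.
apply: eps2_Mdist_estimate; rewrite ?(Cp_absval2_ge Cp_v) //.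
exact: parabolic_trace nz2 (Cp_sqrt Cp_v) g_parabolic.
Qed.
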